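(* Let $R$ be a commutative unital ring and let $I$ be any ideal of $R$. Put $$\mathfrak{E}:=(R\text{-Mod})_{I\text{-com}}\cap (R\text{-Mod})_{I\text{-cor}},\qquad \mathfrak{D}:=(R\text{-Mod})_{I\text{-tor}}\cap (R\text{-Mod})_{I\text{-red}}.$$ 1. For any $M\in (R\text{-Mod})_{I\text{-red}}$, $\Gamma_I(M)\in \mathfrak{E}$. 2. For any $M\in (R\text{-Mod})_{I\text{-cor}}$, $\Lambda_I(M)\in \mathfrak{D}$. 3. The functor $\Gamma_I : (R\text{-Mod})_{I\text{-red}}\rightarrow (R\text{-Mod})_{I\text{-cor}}$ restricted to $\mathfrak{D}$ is an equivalence between $\mathfrak{D}$ and $\mathfrak{E}$ with quasi-inverse $\Lambda_I$.
   Context: $R\text{-Mod}$ is the category of $R$-modules. The $I$-torsion functor is $\Gamma_I(M):=\varinjlim_k \mathrm{Hom}_R(R/I^k, M)$ and the $I$-adic completion functor is $\Lambda_I(M):=\varprojlim_k M/I^kM$, both endofunctors of $R\text{-Mod}$. For an $R$-module $M$ and $a\in R$ let $f_a:M\to M$ be $m\mapsto am$, and $f_a^2=f_a\circ f_a$. $M$ is $I$-reduced if $\mathrm{Ker} f_a\cong \mathrm{Ker} f_a^2$ for every $a\in I$, and $I$-coreduced if $\mathrm{Coker} f_a\cong \mathrm{Coker} f_a^2$ for every $a\in I$. $M$ is $I$-torsion if $\Gamma_I(M)\cong M$ and $I$-complete if $\Lambda_I(M)\cong M$. $(R\text{-Mod})_{I\text{-red}}$, $(R\text{-Mod})_{I\text{-cor}}$,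 $(R\text{-Mod})_{I\text{-tor}}$, $(R\text{-Mod})_{I\text{-com}}$ denote the full subcategories of $R\text{-Mod}$ of all $I$-reduced, $I$-coreduced, $I$-torsion, $I$-complete $R$-modules, respectively. *)

(* Defs.v *)
From HB Require Import structures.
From mathcomp Require Import all_boot all_algebra.
From mathcomp Require Import boolp.

Set Implicit Arguments.
Unset Strict Implicit.
Unset Printing Implicit Defensive.

Import GRing.Theory.

Local Open Scope ring_scope.
Local Open Scope quotient_scope.

Lemma linear_ext (R : pzRingType) (U V : lmodType R) (f g : {linear U -> V}) :
  f =1 g -> f = g.
Proof.
case: f g => [f cf] [g cg] /= /funext fg.
move: fg cf cg => -> [[a] [b]] [[a'] [b']].
by rewrite (Prop_irrelevance a a') (Prop_irrelevance b b').
Qed.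

(** An abstract isomorphism: no compatibility with a canonical map between the
    two modules is required. *)
Definition isomorphic_modules (R : pzRingType) (U V : lmodType R) : Prop :=
  exists f : {linear U -> V}, bijective f.

Section HomModule.
Variables (R : comPzRingType) (U V : lmodType R).

Definition hom_module : Type := {linear U -> V}.

HB.instance Definition _ := gen_eqMixin hom_module.
HB.instance Definition _ := gen_choiceMixin hom_module.

Implicit Types f g h : hom_module.

Definition hom_zero : hom_module := (\0 : U -> V).
Definition hom_add f g : hom_module :=
  ((f : {linear U -> V}) \+ (g : {linear U -> V}))%R.
Definition hom_opp f : hom_module := (\- (f : {linear U -> V}))%R.
Definition hom_scale (a : R) f : hom_module := (a \*: (f : {linear U -> V}))%R.

Let hom_addA : associative hom_add.
Proof. by move=> f g h; apply: linear_ext => x /=; rewrite addrA. Qed.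
Let hom_addC : commutative hom_add.
Proof. by move=> f g; apply: linear_ext => x /=; rewrite addrC. Qed.
Let hom_add0 : left_id hom_zero hom_add.
Proof. by move=> f; apply: linear_ext => x /=; rewrite add0r. Qed.
Let hom_addN : left_inverse hom_zero hom_opp hom_add.
Proof. by move=> f; apply: linear_ext => x /=; rewrite addNr. Qed.

HB.instance Definition _ :=
  GRing.isZmodule.Build hom_module hom_addA hom_addC hom_add0 hom_addN.

Let hom_scaleA a b f : hom_scale a (hom_scale b f) = hom_scale (a * b) f.
Proof. by apply: linear_ext => x /=; rewrite scalerA. Qed.
Let hom_scale1 : left_id 1 hom_scale.
Proof. by move=> f; apply: linear_ext => x /=; rewrite scale1r. Qed.
Let hom_scaleDr : right_distributive hom_scale +%R.
Proof. by move=> a f g; apply: linear_ext => x /=; rewrite scalerDr. Qed.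
Let hom_scaleDl f : {morph hom_scale^~ f : a b / a + b}.
Proof. by move=> a b; apply: linear_ext => x /=; rewrite scalerDl. Qed.

HB.instance Definition _ := GRing.Zmodule_isLmodule.Build R hom_module
  hom_scaleA hom_scale1 hom_scaleDr hom_scaleDl.

End HomModule.

Section Submodule.
Variables (R : pzRingType) (V : lmodType R) (S : submodClosed V).

Definition submodule : Type := {x : V | x \in S}.
HB.instance Definition _ := SubChoice.on submodule.
HB.instance Definition _ := [SubChoice_isSubLmodule of submodule by <:].

(** [submodClosed] does not inherit from [zmodClosed] in the library. *)
Definition submod_pred : {pred V} := S.
Fact submod_pred_closed : submod_closed submod_pred.
Proof. exact: submodClosedP. Qed.
HB.instance Definition _ := GRing.isSubmodClosed.Build R V submod_pred
  submod_pred_closed.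

Definition quotient_module : Type := Quotient.quot submod_pred.
HB.instance Definition _ := GRing.Zmodule.on quotient_module.

Definition quot_proj (v : V) : quotient_module :=
  \pi_(Quotient.quot submod_pred) v.

Lemma quot_projP (x : quotient_module) : exists v, x = quot_proj v.
Proof. by exists (repr x); rewrite /quot_proj reprK. Qed.

Lemma quot_proj_eq u v : (quot_proj u = quot_proj v) <-> (u - v \in S).
Proof.
rewrite -[u - v \in S]/(u - v \in submod_pred) Quotient.idealrBE.
by split=> [|/eqP//]; move=> e; apply/eqP.
Qed.

Let quot_projB : zmod_morphism quot_proj.
Proof. by move=> u v; rewrite /quot_proj; exact: raddfB. Qed.

Definition quot_scale (a : R) (x : quotient_module) : quotient_module :=
  quot_proj (a *: repr (x : Quotient.quot submod_pred)).

Let quot_scaleE a v : quot_scale a (quot_proj v) = quot_proj (a *: v).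
Proof.
apply/quot_proj_eq; rewrite -scalerBr rpredZ//; apply/quot_proj_eq.
by rewrite /quot_proj reprK.
Qed.

Let quot_projD u v : quot_proj (u + v) = quot_proj u + quot_proj v.
Proof. by rewrite -[v in LHS]opprK !quot_projB -[- v]sub0r quot_projB
  -[0 in X in _ - X]subr0 !quot_projB subrr sub0r opprK. Qed.

Let quot_scaleA a b x : quot_scale a (quot_scale b x) = quot_scale (a * b) x.
Proof. by have [v ->] := quot_projP x; rewrite !quot_scaleE scalerA. Qed.
Let quot_scale1 : left_id 1 quot_scale.
Proof. by move=> x; have [v ->] := quot_projP x; rewrite quot_scaleE scale1r. Qed.
Let quot_scaleDr : right_distributive quot_scale +%R.
Proof.
move=> a x y; have [[u ->] [v ->]] := (quot_projP x, quot_projP y).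
by rewrite -quot_projD !quot_scaleE scalerDr quot_projD.
Qed.
Let quot_scaleDl x : {morph quot_scale^~ x : a b / a + b}.
Proof.
move=> a b; have [v ->] := quot_projP x.
by rewrite !quot_scaleE scalerDl quot_projD.
Qed.

HB.instance Definition _ := GRing.Zmodule_isLmodule.Build R quotient_module
  quot_scaleA quot_scale1 quot_scaleDr quot_scaleDl.

Fact quot_proj_linear : linear quot_proj.
Proof. by move=> a u v; rewrite quot_projD -quot_scaleE. Qed.
HB.instance Definition _ :=
  GRing.isLinear.Build R V quotient_module _ quot_proj quot_proj_linear.

End Submodule.

Section QuotientLift.
Variables (R : pzRingType) (V W : lmodType R) (S : submodClosed V).
Variables (f : {linear V -> W}) (f0 : forall v, v \in S -> f v = 0).

#[using="f0"]
Definition quot_lift (x : quotient_module S) : W :=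
  f (repr (x : Quotient.quot (submod_pred S))).

Lemma quot_liftE v : quot_lift (quot_proj S v) = f v.
Proof.
apply/eqP; rewrite -subr_eq0 -raddfB; apply/eqP/f0/quot_proj_eq.
by rewrite /quot_proj reprK.
Qed.

Fact quot_lift_linear : linear quot_lift.
Proof.
move=> a x y; have [[u ->] [v ->]] := (quot_projP x, quot_projP y).
by rewrite -linearP !quot_liftE linearP.
Qed.
HB.instance Definition _ := GRing.isLinear.Build R (quotient_module S) W _
  quot_lift quot_lift_linear.

End QuotientLift.
Arguments quot_lift : simpl never.

Section QuotientMap.
Variables (R : pzRingType) (V W : lmodType R).
Variables (S : submodClosed V) (T : submodClosed W) (f : {linear V -> W}).
Variable fST : forall v, v \in S -> f v \in T.

Fact quot_map_subproof v : v \in S -> (quot_proj T \o f) v = 0.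
Proof.
by move=> /fST vT; rewrite /= -(raddf0 (quot_proj T)); apply/quot_proj_eq;
  rewrite subr0.
Qed.
Definition quot_map : {linear quotient_module S -> quotient_module T} :=
  quot_lift quot_map_subproof.

Lemma quot_mapE v : quot_map (quot_proj S v) = quot_proj T (f v).
Proof. exact: quot_liftE. Qed.

End QuotientMap.
Arguments quot_map : simpl never.

Section KerCoker.
Variables (R : pzRingType) (U V : lmodType R) (f : {linear U -> V}).

Definition ker_pred : {pred U} := fun x => f x == 0.
Fact ker_pred_closed : submod_closed ker_pred.
Proof.
split=> [|a x y]; rewrite !unfold_in ?raddf0// => /eqP fx /eqP fy.
by rewrite linearP fx fy scaler0 addr0.
Qed.
HB.instance Definition _ :=
  GRing.isSubmodClosed.Build R U ker_pred ker_pred_closed.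

Definition im_pred : {pred V} := fun y => `[< exists x, y = f x >].
Fact im_pred_closed : submod_closed im_pred.
Proof.
split=> [|a x y]; rewrite !unfold_in; first by apply/asboolP; exists 0; rewrite raddf0.
move=> /asboolP[u ->] /asboolP[v ->]; apply/asboolP.
by exists (a *: u + v); rewrite linearP.
Qed.
HB.instance Definition _ :=
  GRing.isSubmodClosed.Build R V im_pred im_pred_closed.

Definition ker : lmodType R := submodule ker_pred.
Definition coker : lmodType R := quotient_module im_pred.

End KerCoker.

Section IdealProduct.
Variable R : comPzRingType.

Definition full_pred (V : lmodType R) : {pred V} := fun=> true.
Fact full_pred_closed (V : lmodType R) : submod_closed (@full_pred V).
Proof. by []. Qed.
HB.instance Definition _ (V : lmodType R) :=
  GRing.isSubmodClosed.Build R V (@full_pred V) (@full_pred_closed V).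

Section Smul.
Variables (J : {pred R}) (V : lmodType R) (N : submodClosed V).

(** The submodule [J N] of [V]: all finite sums of products [a *: x]. *)
Definition smul : {pred V} := fun v =>
  `[< exists (n : nat) (a : 'I_n -> R) (x : 'I_n -> V),
        (forall i, a i \in J /\ x i \in N) /\ v = \sum_(i < n) a i *: x i >].

Fact smul_closed : submod_closed smul.
Proof.
split=> [|c u v]; rewrite !unfold_in.
  by apply/asboolP; exists 0%N, (fun=> 0), (fun=> 0); split=> [[]//|];
    rewrite big_ord0.
move=> /asboolP[n [a [x [ax ->]]]] /asboolP[m [b [y [bY ->]]]].
apply/asboolP; exists (n + m)%N.
exists (fun i => match split i with inl j => a j | inr j => b j end).
exists (fun i => match split i with inl j => c *: x j | inr j => y j end).
split=> [i|].
  by case: split => j; [have [? ?] := ax j; split=> //; rewrite rpredZ|exact: bY].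
rewrite big_split_ord scaler_sumr; congr (_ + _); apply: eq_bigr => i _.
  by rewrite (unsplitK (inl i)) !scalerA mulrC.
by rewrite (unsplitK (inr i)).
Qed.
HB.instance Definition _ := GRing.isSubmodClosed.Build R V smul smul_closed.
End Smul.

(** An ideal of [R] is a submodule of the regular module [R^o]; it may be
    improper, which the library's [idealr] excludes. Limits below start at
    [I ^ 0 = R], whose term [R / R] or [M / M] is zero. *)
Fixpoint ideal_pow (I : submodClosed R^o) (k : nat) : submodClosed R^o :=
  if k is k'.+1 then smul I (ideal_pow I k') else @full_pred R^o.

Definition pow_smul (I : submodClosed R^o) (k : nat) (V : lmodType R) :
  submodClosed V := smul (ideal_pow I k) (@full_pred V).

Lemma smulS (J K : {pred R}) (V : lmodType R) (N P : submodClosed V) :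
  {subset J <= K} -> {subset N <= P} -> {subset smul J N <= smul K P}.
Proof.
move=> JK NP v; rewrite !unfold_in => /asboolP[n [a [x [ax ->]]]].
apply/asboolP; exists n, a, x; split=> // i.
by have [/JK ? /NP ?] := ax i.
Qed.

Lemma ideal_pow_le (I : submodClosed R^o) (i j : nat) : (i <= j)%N ->
  {subset ideal_pow I j <= ideal_pow I i}.
Proof.
elim: j i => [|j IHj] [|i] //= ij.
by apply: smulS => //; exact: IHj.
Qed.

Lemma pow_smul_le (I : submodClosed R^o) (i j : nat) (V : lmodType R) :
  (i <= j)%N -> {subset pow_smul I j V <= pow_smul I i V}.
Proof. by move=> ij; apply: smulS => //; exact: ideal_pow_le. Qed.

Lemma pow_smul_map (I : submodClosed R^o) (k : nat) (U V : lmodType R)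
  (f : {linear U -> V}) u : u \in pow_smul I k U -> f u \in pow_smul I k V.
Proof.
rewrite !unfold_in => /asboolP[n [a [x [ax ->]]]]; apply/asboolP.
exists n, a, (f \o x); split=> [i|]; first by have [] := ax i.
by rewrite linear_sum; apply: eq_bigr => i _; rewrite linearZ.
Qed.

End IdealProduct.

Record direct_system (R : pzRingType) := DirectSystem {
  dobj :> nat -> lmodType R;
  dmap : forall i j, (i <= j)%N -> {linear dobj i -> dobj j};
  dmap_id : forall i (h : (i <= i)%N) x, dmap h x = x;
  dmap_comp : forall i j k (h1 : (i <= j)%N) (h2 : (j <= k)%N)
    (h3 : (i <= k)%N) x, dmap h2 (dmap h1 x) = dmap h3 x }.
Arguments dmap {R d i j} h.

Section DirectLimit.
Variables (R : pzRingType) (D : direct_system R).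

Definition dsum : Type := {i : nat & D i}.
HB.instance Definition _ := Choice.on dsum.

(** Two elements of the disjoint union have the same class in the limit when
    they become equal at some later stage. *)
Definition dequiv (x y : dsum) : bool :=
  `[< exists k (hx : (tag x <= k)%N) (hy : (tag y <= k)%N),
        dmap hx (tagged x) = dmap hy (tagged y) >].

Fact dequiv_equiv : equiv_class_of dequiv.
Proof.
split=> [x|x y|y x z].
- by apply/asboolP; exists (tag x), (leqnn _), (leqnn _).
- by apply/asboolP/asboolP => -[k [h1 [h2 e]]]; exists k, h2, h1.
move=> /asboolP[k [hx [hy e]]] /asboolP[l [hy' [hz e']]].
have hk := leq_maxl k l; have hl := leq_maxr k l.
apply/asboolP; exists (maxn k l), (leq_trans hx hk), (leq_trans hz hl).
rewrite -(dmap_comp hx hk) e -(dmap_comp hz hl) -e'.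
by rewrite (dmap_comp _ _ (leq_trans hy hk)) (dmap_comp _ _ (leq_trans hy hk)).
Qed.
Canonical dequiv_equivRel := EquivRelPack dequiv_equiv.
Canonical dequiv_encModRel := defaultEncModRel dequiv.

Definition dirlim : Type := {eq_quot dequiv}.
HB.instance Definition _ := Choice.on dirlim.

Definition dirlim_in i (x : D i) : dirlim :=
  \pi_{eq_quot dequiv} (Tagged (fun i => D i) x).

Lemma dirlim_in_eq i j (x : D i) (y : D j) :
  dirlim_in x = dirlim_in y <->
  exists k (hi : (i <= k)%N) (hj : (j <= k)%N), dmap hi x = dmap hj y.
Proof. by split=> [/eqmodP/asboolP|h]; last by apply/eqmodP/asboolP. Qed.

Lemma dirlim_in_map i j (h : (i <= j)%N) (x : D i) :
  dirlim_in (dmap h x) = dirlim_in x.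
Proof.
by apply/dirlim_in_eq; exists j, (leqnn j), h; rewrite dmap_id.
Qed.

Lemma dirlimP (x : dirlim) : exists i (u : D i), x = dirlim_in u.
Proof.
exists (tag (repr x)), (tagged (repr x)).
by rewrite /dirlim_in -[LHS]reprK; congr (\pi _); case: (repr x).
Qed.

Lemma dirlimP2 (x y : dirlim) :
  exists i (u v : D i), x = dirlim_in u /\ y = dirlim_in v.
Proof.
have [[i [u ->]] [j [v ->]]] := (dirlimP x, dirlimP y).
exists (maxn i j), (dmap (leq_maxl i j) u), (dmap (leq_maxr i j) v).
by rewrite !dirlim_in_map.
Qed.

Definition dirlim_add (x y : dirlim) : dirlim :=
  let u := repr x in let v := repr y in
  dirlim_in (dmap (leq_maxl (tag u) (tag v)) (tagged u) +
             dmap (leq_maxr (tag u) (tag v)) (tagged v)).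
Definition dirlim_scale (a : R) (x : dirlim) : dirlim :=
  dirlim_in (a *: tagged (repr x)).

Let repr_in i (u : D i) : exists k (h : (tag (repr (dirlim_in u)) <= k)%N)
  (hi : (i <= k)%N), dmap h (tagged (repr (dirlim_in u))) = dmap hi u.
Proof.
apply/dirlim_in_eq; rewrite /dirlim_in -[RHS]reprK; congr (\pi _).
by case: (repr _).
Qed.

Lemma dirlim_addE i (u v : D i) :
  dirlim_add (dirlim_in u) (dirlim_in v) = dirlim_in (u + v).
Proof.
have [k [h [hi e]]] := repr_in u; have [l [h' [hi' e']]] := repr_in v.
rewrite /dirlim_add; apply/dirlim_in_eq.
set m1 := leq_maxl _ _; set m2 := leq_maxr _ _; move: m1 m2.
set p := maxn _ _ => m1 m2.
pose q := maxn p (maxn k l).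
have kq : (k <= q)%N by rewrite leq_max leq_maxl orbT.
have lq : (l <= q)%N by rewrite leq_max leq_maxr orbT.
exists q, (leq_maxl _ _), (leq_trans hi kq); rewrite !raddfD/=.
rewrite (dmap_comp _ _ (leq_trans h kq)) (dmap_comp _ _ (leq_trans h' lq)).
rewrite -(dmap_comp h kq) e -(dmap_comp h' lq) e'.
by rewrite (dmap_comp _ _ (leq_trans hi kq)) (dmap_comp _ _ (leq_trans hi kq)).
Qed.

Lemma dirlim_scaleE a i (u : D i) :
  dirlim_scale a (dirlim_in u) = dirlim_in (a *: u).
Proof.
have [k [h [hi e]]] := repr_in u; apply/dirlim_in_eq.
by exists k, h, hi; rewrite !linearZ/= e.
Qed.

Definition dirlim_zero : dirlim := dirlim_in (0 : D 0%N).
Definition dirlim_opp : dirlim -> dirlim := dirlim_scale (-1).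

Let dirlim_zeroE i : dirlim_in (0 : D i) = dirlim_zero.
Proof.
by rewrite /dirlim_zero -(dirlim_in_map (leq0n i)) raddf0.
Qed.

Let dirlim_addA : associative dirlim_add.
Proof.
move=> x y z; have [i [u [v [-> ->]]]] := dirlimP2 x y.
have [j [w ->]] := dirlimP z.
rewrite -(dirlim_in_map (leq_maxl i j) u) -(dirlim_in_map (leq_maxl i j) v).
by rewrite -(dirlim_in_map (leq_maxr i j) w) !dirlim_addE addrA.
Qed.
Let dirlim_addC : commutative dirlim_add.
Proof.
move=> x y; have [i [u [v [-> ->]]]] := dirlimP2 x y.
by rewrite !dirlim_addE addrC.
Qed.
Let dirlim_add0 : left_id dirlim_zero dirlim_add.
Proof.
move=> x; have [i [u ->]] := dirlimP x.
by rewrite -(dirlim_zeroE i) dirlim_addE add0r.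
Qed.
Let dirlim_addN : left_inverse dirlim_zero dirlim_opp dirlim_add.
Proof.
move=> x; have [i [u ->]] := dirlimP x.
by rewrite /dirlim_opp dirlim_scaleE dirlim_addE scaleN1r addNr dirlim_zeroE.
Qed.
HB.instance Definition _ := GRing.isZmodule.Build dirlim
  dirlim_addA dirlim_addC dirlim_add0 dirlim_addN.

Let dirlim_scaleA a b x :
  dirlim_scale a (dirlim_scale b x) = dirlim_scale (a * b) x.
Proof. by have [i [u ->]] := dirlimP x; rewrite !dirlim_scaleE scalerA. Qed.
Let dirlim_scale1 : left_id 1 dirlim_scale.
Proof.
by move=> x; have [i [u ->]] := dirlimP x; rewrite dirlim_scaleE scale1r.
Qed.
Let dirlim_scaleDr : right_distributive dirlim_scale +%R.
Proof.
move=> a x y; have [i [u [v [-> ->]]]] := dirlimP2 x y.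
rewrite [_ + _]dirlim_addE !dirlim_scaleE scalerDr.
by rewrite [RHS]dirlim_addE.
Qed.
Let dirlim_scaleDl x : {morph dirlim_scale^~ x : a b / a + b}.
Proof.
move=> a b; have [i [u ->]] := dirlimP x.
by rewrite !dirlim_scaleE scalerDl [RHS]dirlim_addE.
Qed.
HB.instance Definition _ := GRing.Zmodule_isLmodule.Build R dirlim
  dirlim_scaleA dirlim_scale1 dirlim_scaleDr dirlim_scaleDl.

Fact dirlim_in_linear i : linear (@dirlim_in i).
Proof.
move=> a u v; rewrite -[RHS]/(dirlim_add (dirlim_scale a _) _).
by rewrite dirlim_scaleE dirlim_addE.
Qed.
HB.instance Definition _ i := GRing.isLinear.Build R (D i) dirlim _
  (@dirlim_in i) (@dirlim_in_linear i).

Section Rec.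
Variables (W : lmodType R) (g : forall i, {linear D i -> W}).
Hypothesis gP : forall i j (h : (i <= j)%N) x, g j (dmap h x) = g i x.

#[using="gP"]
Definition dirlim_rec (x : dirlim) : W := g (tag (repr x)) (tagged (repr x)).

Lemma dirlim_recE i (u : D i) : dirlim_rec (dirlim_in u) = g i u.
Proof.
have [k [h [hi e]]] := repr_in u.
by rewrite /dirlim_rec -(gP h) e gP.
Qed.

Fact dirlim_rec_linear : linear dirlim_rec.
Proof.
move=> a x y; have [i [u [v [-> ->]]]] := dirlimP2 x y.
by rewrite -linearP !dirlim_recE linearP.
Qed.
HB.instance Definition _ :=
  GRing.isLinear.Build R dirlim W _ dirlim_rec dirlim_rec_linear.
End Rec.

End DirectLimit.
Arguments dirlim_in : simpl never.
Arguments dirlim_rec : simpl never.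

Section DirectLimitMap.
Variables (R : pzRingType) (D E : direct_system R).
Variable phi : forall i, {linear D i -> E i}.
Hypothesis phiP :
  forall i j (h : (i <= j)%N) x, phi j (dmap h x) = dmap h (phi i x).

Fact dirlim_map_subproof i j (h : (i <= j)%N) x :
  (@dirlim_in _ E j \o phi j) (dmap h x) = (@dirlim_in _ E i \o phi i) x.
Proof. by rewrite /= phiP dirlim_in_map. Qed.

Definition dirlim_map : {linear dirlim D -> dirlim E} :=
  dirlim_rec dirlim_map_subproof.

Lemma dirlim_mapE i (x : D i) :
  dirlim_map (dirlim_in x) = dirlim_in (phi i x).
Proof. exact: (dirlim_recE dirlim_map_subproof). Qed.
End DirectLimitMap.
Arguments dirlim_map : simpl never.

Record inverse_system (R : pzRingType) := InverseSystem {
  iobj :> nat -> lmodType R;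
  imap : forall i j, (i <= j)%N -> {linear iobj j -> iobj i};
  imap_id : forall i (h : (i <= i)%N) x, imap h x = x;
  imap_comp : forall i j k (h1 : (i <= j)%N) (h2 : (j <= k)%N)
    (h3 : (i <= k)%N) x, imap h1 (imap h2 x) = imap h3 x }.
Arguments imap {R s i j} h : rename.

Section InverseLimit.
Variables (R : pzRingType) (D : inverse_system R).

Definition iprod : Type := forall i, D i.
HB.instance Definition _ := Choice.on iprod.

Implicit Types x y z : iprod.
Definition iprod_zero : iprod := fun=> 0.
Definition iprod_add x y : iprod := fun i => x i + y i.
Definition iprod_opp x : iprod := fun i => - x i.
Definition iprod_scale (a : R) x : iprod := fun i => a *: x i.

Let iprod_addA : associative iprod_add.
Proof. by move=> x y z; apply: functional_extensionality_dep => i; exact: addrA. Qed.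
Let iprod_addC : commutative iprod_add.
Proof. by move=> x y; apply: functional_extensionality_dep => i; exact: addrC. Qed.
Let iprod_add0 : left_id iprod_zero iprod_add.
Proof. by move=> x; apply: functional_extensionality_dep => i; exact: add0r. Qed.
Let iprod_addN : left_inverse iprod_zero iprod_opp iprod_add.
Proof. by move=> x; apply: functional_extensionality_dep => i; exact: addNr. Qed.
HB.instance Definition _ := GRing.isZmodule.Build iprod
  iprod_addA iprod_addC iprod_add0 iprod_addN.

Let iprod_scaleA a b x : iprod_scale a (iprod_scale b x) = iprod_scale (a * b) x.
Proof. by apply: functional_extensionality_dep => i; exact: scalerA. Qed.
Let iprod_scale1 : left_id 1 iprod_scale.
Proof. by move=> x; apply: functional_extensionality_dep => i; exact: scale1r. Qed.
Let iprod_scaleDr : right_distributive iprod_scale +%R.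
Proof.
by move=> a x y; apply: functional_extensionality_dep => i; exact: scalerDr.
Qed.
Let iprod_scaleDl x : {morph iprod_scale^~ x : a b / a + b}.
Proof.
by move=> a b; apply: functional_extensionality_dep => i; exact: scalerDl.
Qed.
HB.instance Definition _ := GRing.Zmodule_isLmodule.Build R iprod
  iprod_scaleA iprod_scale1 iprod_scaleDr iprod_scaleDl.

Definition compatible : {pred iprod} :=
  fun x => `[< forall i j (h : (i <= j)%N), imap h (x j) = x i >].
Fact compatible_closed : submod_closed compatible.
Proof.
split=> [|a x y]; rewrite !unfold_in.
  by apply/asboolP => i j h; rewrite raddf0.
move=> /asboolP xP /asboolP yP; apply/asboolP => i j h.
by rewrite linearP xP yP.
Qed.
HB.instance Definition _ :=
  GRing.isSubmodClosed.Build R iprod compatible compatible_closed.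

Definition invlim : lmodType R := submodule compatible.

Definition invlim_proj i (x : invlim) : D i := val x i.
Fact invlim_proj_linear i : linear (@invlim_proj i).
Proof. by []. Qed.
HB.instance Definition _ i := GRing.isLinear.Build R invlim (D i) _
  (@invlim_proj i) (@invlim_proj_linear i).

Lemma invlim_ext (x y : invlim) :
  (forall i, invlim_proj i x = invlim_proj i y) -> x = y.
Proof. by move=> xy; apply/val_inj/functional_extensionality_dep. Qed.

Lemma invlim_projP (x : invlim) i j (h : (i <= j)%N) :
  imap h (invlim_proj j x) = invlim_proj i x.
Proof. by case: x => x xP; move: xP (xP) => /asboolP. Qed.

Section Lift.
Variables (W : lmodType R) (g : forall i, {linear W -> D i}).
Hypothesis gP : forall i j (h : (i <= j)%N) w, imap h (g j w) = g i w.

Fact invlim_lift_subproof w : (fun i => g i w : D i) \in compatible.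
Proof. by apply/asboolP => i j h; exact: gP. Qed.
Definition invlim_lift (w : W) : invlim :=
  exist _ (fun i => g i w : D i) (invlim_lift_subproof w).
Fact invlim_lift_linear : linear invlim_lift.
Proof. by move=> a u v; apply: invlim_ext => i; exact: linearP. Qed.
HB.instance Definition _ :=
  GRing.isLinear.Build R W invlim _ invlim_lift invlim_lift_linear.

Lemma invlim_liftE i w : invlim_proj i (invlim_lift w) = g i w.
Proof. by []. Qed.
End Lift.

End InverseLimit.
Arguments invlim_proj : simpl never.
Arguments invlim_lift : simpl never.

Section InverseLimitMap.
Variables (R : pzRingType) (D E : inverse_system R).
Variable phi : forall i, {linear D i -> E i}.
Hypothesis phiP :
  forall i j (h : (i <= j)%N) x, phi i (imap h x) = imap h (phi j x).

Fact invlim_map_subproof i j (h : (i <= j)%N) x :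
  imap h ((phi j \o @invlim_proj _ D j) x) = (phi i \o @invlim_proj _ D i) x.
Proof. by rewrite /= -phiP invlim_projP. Qed.

Definition invlim_map : {linear invlim D -> invlim E} :=
  invlim_lift invlim_map_subproof.

Lemma invlim_mapE i x : invlim_proj i (invlim_map x) = phi i (invlim_proj i x).
Proof. by []. Qed.
End InverseLimitMap.
Arguments invlim_map : simpl never.

Record category := Category {
  ob :> Type;
  hom : ob -> ob -> Type;
  idm : forall X, hom X X;
  compm : forall X Y Z, hom Y Z -> hom X Y -> hom X Z;
  comp_idl : forall X Y (f : hom X Y), compm (idm Y) f = f;
  comp_idr : forall X Y (f : hom X Y), compm f (idm X) = f;
  comp_assoc : forall X Y Z T (f : hom Z T) (g : hom Y Z) (h : hom X Y),
    compm f (compm g h) = compm (compm f g) h }.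

Record functor (C D : category) := Functor {
  fob :> C -> D;
  fmap : forall X Y, hom X Y -> hom (fob X) (fob Y);
  fmap_id : forall X, fmap (idm X) = idm (fob X);
  fmap_comp : forall X Y Z (f : hom Y Z) (g : hom X Y),
    fmap (compm f g) = compm (fmap f) (fmap g) }.

Definition functor_id (C : category) : functor C C :=
  @Functor C C id (fun _ _ f => f) (fun=> erefl) (fun _ _ _ _ _ => erefl).

Section FunctorComp.
Variables (C D E : category) (G : functor D E) (F : functor C D).
Fact functor_comp_id X : fmap G (fmap F (idm X)) = idm (G (F X)).
Proof. by rewrite !fmap_id. Qed.
Fact functor_comp_comp X Y Z (f : hom Y Z) (g : hom X Y) :
  fmap G (fmap F (compm f g)) = compm (fmap G (fmap F f)) (fmap G (fmap F g)).
Proof. by rewrite !fmap_comp. Qed.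
Definition functor_comp : functor C E :=
  @Functor C E (fun X => G (F X)) (fun _ _ f => fmap G (fmap F f))
    functor_comp_id functor_comp_comp.
End FunctorComp.

Definition is_iso (C : category) (X Y : C) (f : hom X Y) : Prop :=
  exists g : hom Y X, compm g f = idm X /\ compm f g = idm Y.

Definition naturally_isomorphic (C D : category) (F G : functor C D) : Prop :=
  exists eta : forall X : C, hom (F X) (G X),
    (forall X, is_iso (eta X)) /\
    (forall X Y (f : hom X Y),
       compm (eta Y) (fmap F f) = compm (fmap G f) (eta X)).

Definition is_equivalence_with_quasi_inverse (C D : category)
    (F : functor C D) (G : functor D C) : Prop :=
  naturally_isomorphic (functor_comp G F) (functor_id C) /\
  naturally_isomorphic (functor_comp F G) (functor_id D).

Definition full_subcategory (C : category) (P : C -> Prop) : category :=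
  @Category {X : C | P X} (fun X Y => hom (sval X) (sval Y))
    (fun X => idm (sval X)) (fun _ _ _ f g => compm f g)
    (fun _ _ f => comp_idl f) (fun _ _ f => comp_idr f)
    (fun _ _ _ _ f g h => comp_assoc f g h).

Definition restrict_functor (C D : category) (F : functor C D)
    (P : C -> Prop) (Q : D -> Prop) (PQ : forall X, P X -> Q (F X)) :
    functor (full_subcategory P) (full_subcategory Q) :=
  @Functor (full_subcategory P) (full_subcategory Q)
    (fun X => exist Q (F (sval X)) (PQ (sval X) (svalP X)))
    (fun _ _ f => fmap F f) (fun X => fmap_id F (sval X))
    (fun _ _ _ f g => fmap_comp F f g).

Section ModuleCategory.
Variable R : pzRingType.

Definition lin_id (U : lmodType R) : {linear U -> U} := idfun.
Definition lin_comp (U V W : lmodType R) (f : {linear V -> W})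
  (g : {linear U -> V}) : {linear U -> W} := f \o g.

Fact lin_comp_idl (U V : lmodType R) (f : {linear U -> V}) :
  lin_comp (lin_id V) f = f.
Proof. exact: linear_ext. Qed.
Fact lin_comp_idr (U V : lmodType R) (f : {linear U -> V}) :
  lin_comp f (lin_id U) = f.
Proof. exact: linear_ext. Qed.
Fact lin_comp_assoc (U V W X : lmodType R) (f : {linear W -> X})
    (g : {linear V -> W}) (h : {linear U -> V}) :
  lin_comp f (lin_comp g h) = lin_comp (lin_comp f g) h.
Proof. exact: linear_ext. Qed.

Definition Mod : category := @Category (lmodType R)
  (fun U V => {linear U -> V}) lin_id lin_comp
  lin_comp_idl lin_comp_idr lin_comp_assoc.

End ModuleCategory.
Arguments Mod : clear implicits.

Section TorsionCompletion.
Variables (R : comPzRingType) (I : submodClosed R^o).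

Definition ring_quot (k : nat) : lmodType R := quotient_module (ideal_pow I k).

Definition ring_quot_map i j (h : (i <= j)%N) :
    {linear ring_quot j -> ring_quot i} :=
  @quot_map R R^o R^o (ideal_pow I j) (ideal_pow I i) idfun
    (ideal_pow_le h).

Lemma ring_quot_mapE i j (h : (i <= j)%N) r :
  ring_quot_map h (quot_proj (ideal_pow I j) r) = quot_proj (ideal_pow I i) r.
Proof. exact: quot_mapE. Qed.

Section Torsion.
Variable M : lmodType R.

(** The transition maps precompose with the projections
    [R / I ^ j -> R / I ^ i]. *)
Definition torsion_trans i j (h : (i <= j)%N)
    (f : hom_module (ring_quot i) M) : hom_module (ring_quot j) M :=
  lin_comp f (ring_quot_map h).

Fact torsion_trans_linear i j (h : (i <= j)%N) : linear (torsion_trans h).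
Proof. by move=> a f g; apply: linear_ext. Qed.
HB.instance Definition _ i j (h : (i <= j)%N) :=
  GRing.isLinear.Build R (hom_module (ring_quot i) M)
    (hom_module (ring_quot j) M) _ (torsion_trans h) (torsion_trans_linear h).

Fact torsion_trans_id i (h : (i <= i)%N) f : torsion_trans h f = f.
Proof.
by apply: linear_ext => x; have [r ->] := quot_projP x; rewrite /= ring_quot_mapE.
Qed.
Fact torsion_trans_comp i j k (h1 : (i <= j)%N) (h2 : (j <= k)%N)
    (h3 : (i <= k)%N) f :
  torsion_trans h2 (torsion_trans h1 f) = torsion_trans h3 f.
Proof.
apply: linear_ext => x; have [r ->] := quot_projP x; rewrite /=.
by rewrite (ring_quot_mapE h2) !ring_quot_mapE.
Qed.

Definition torsion_system : direct_system R :=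
  @DirectSystem R (fun k => hom_module (ring_quot k) M)
    (fun i j h => torsion_trans h) torsion_trans_id torsion_trans_comp.

Definition Gamma : lmodType R := dirlim torsion_system.

Definition completion_trans i j (h : (i <= j)%N) :
    {linear quotient_module (pow_smul I j M) ->
            quotient_module (pow_smul I i M)} :=
  @quot_map R M M (pow_smul I j M) (pow_smul I i M) idfun (pow_smul_le h).

Lemma completion_transE i j (h : (i <= j)%N) m :
  completion_trans h (quot_proj (pow_smul I j M) m) =
  quot_proj (pow_smul I i M) m.
Proof. exact: quot_mapE. Qed.

Fact completion_trans_id i (h : (i <= i)%N) x : completion_trans h x = x.
Proof. by have [m ->] := quot_projP x; rewrite completion_transE. Qed.
Fact completion_trans_comp i j k (h1 : (i <= j)%N) (h2 : (j <= k)%N)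
    (h3 : (i <= k)%N) x :
  completion_trans h1 (completion_trans h2 x) = completion_trans h3 x.
Proof.
by have [m ->] := quot_projP x; rewrite /completion_trans !quot_mapE.
Qed.

Definition completion_system : inverse_system R :=
  @InverseSystem R (fun k => quotient_module (pow_smul I k M))
    completion_trans completion_trans_id completion_trans_comp.

Definition Lambda : lmodType R := invlim completion_system.

End Torsion.

Section Maps.
Variables (M N : lmodType R) (f : {linear M -> N}).

Definition Gamma_comp k (g : hom_module (ring_quot k) M) :
  hom_module (ring_quot k) N := lin_comp f g.
Fact Gamma_comp_linear k : linear (@Gamma_comp k).
Proof. by move=> a g h; apply: linear_ext => x /=; exact: linearP. Qed.
HB.instance Definition _ k := GRing.isLinear.Build R
  (hom_module (ring_quot k) M) (hom_module (ring_quot k) N) _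
  (@Gamma_comp k) (@Gamma_comp_linear k).

Fact Gamma_comp_trans i j (h : (i <= j)%N) g :
  Gamma_comp (torsion_trans h g) = torsion_trans h (Gamma_comp g).
Proof. exact: linear_ext. Qed.

Definition Gamma_map : {linear Gamma M -> Gamma N} :=
  @dirlim_map R (torsion_system M) (torsion_system N)
    (fun k => @Gamma_comp k) Gamma_comp_trans.

Lemma Gamma_mapE k (g : hom_module (ring_quot k) M) :
  Gamma_map (@dirlim_in _ (torsion_system M) k g) =
  @dirlim_in _ (torsion_system N) k (lin_comp f g).
Proof. exact: dirlim_mapE. Qed.

Definition Lambda_comp k :
    {linear quotient_module (pow_smul I k M) ->
            quotient_module (pow_smul I k N)} :=
  @quot_map R M N (pow_smul I k M) (pow_smul I k N) f (@pow_smul_map R I k M N f).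

Lemma Lambda_compE k m : Lambda_comp k (quot_proj (pow_smul I k M) m) =
  quot_proj (pow_smul I k N) (f m).
Proof. exact: quot_mapE. Qed.

Fact Lambda_comp_trans i j (h : (i <= j)%N) x :
  Lambda_comp i (completion_trans M h x) =
  completion_trans N h (Lambda_comp j x).
Proof.
have [m ->] := quot_projP x.
by rewrite completion_transE !Lambda_compE completion_transE.
Qed.

Definition Lambda_map : {linear Lambda M -> Lambda N} :=
  @invlim_map R (completion_system M) (completion_system N)
    Lambda_comp Lambda_comp_trans.

Lemma Lambda_mapE k (x : Lambda M) :
  @invlim_proj _ (completion_system N) k (Lambda_map x) =
  Lambda_comp k (@invlim_proj _ (completion_system M) k x).
Proof. exact: invlim_mapE. Qed.

End Maps.

Fact Gamma_map_id (M : lmodType R) : Gamma_map (lin_id M) = lin_id (Gamma M).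
Proof.
apply: linear_ext => x; have [k [g ->]] := dirlimP x.
by rewrite Gamma_mapE; congr dirlim_in; exact: linear_ext.
Qed.
Fact Gamma_map_comp (M N P : lmodType R) (f : {linear N -> P}) (g : {linear M -> N}) :
  Gamma_map (lin_comp f g) = lin_comp (Gamma_map f) (Gamma_map g).
Proof.
apply: linear_ext => x; have [k [h ->]] := dirlimP x.
rewrite /= (Gamma_mapE g h) !Gamma_mapE; congr dirlim_in.
exact: linear_ext.
Qed.
Definition Gamma_functor : functor (Mod R) (Mod R) :=
  @Functor (Mod R) (Mod R) Gamma Gamma_map Gamma_map_id Gamma_map_comp.

Fact Lambda_map_id (M : lmodType R) : Lambda_map (lin_id M) = lin_id (Lambda M).
Proof.
apply: linear_ext => x; apply: invlim_ext => k; rewrite invlim_mapE /=.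
by have [m ->] := quot_projP (invlim_proj k x); rewrite Lambda_compE.
Qed.
Fact Lambda_map_comp (M N P : lmodType R) (f : {linear N -> P}) (g : {linear M -> N}) :
  Lambda_map (lin_comp f g) = lin_comp (Lambda_map f) (Lambda_map g).
Proof.
apply: linear_ext => x; apply: invlim_ext => k; rewrite /= !Lambda_mapE.
by have [m ->] := quot_projP (invlim_proj k x); rewrite (Lambda_compE g) !Lambda_compE.
Qed.
Definition Lambda_functor : functor (Mod R) (Mod R) :=
  @Functor (Mod R) (Mod R) Lambda Lambda_map Lambda_map_id Lambda_map_comp.

End TorsionCompletion.

Section Homothety.
Variables (R : comPzRingType) (M : lmodType R) (a : R).
(** The endomorphism [f_a]. *)
Definition homothety (m : M) : M := a *: m.
Fact homothety_linear : linear homothety.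
Proof. by move=> b u v; rewrite /homothety scalerDr !scalerA mulrC. Qed.
HB.instance Definition _ :=
  GRing.isLinear.Build R M M _ homothety homothety_linear.
End Homothety.
Arguments homothety {R} M a m.

Section ModuleClasses.
Variables (R : comPzRingType) (I : submodClosed R^o).

Definition I_reduced (M : Mod R) : Prop := forall a : R, a \in I ->
  isomorphic_modules (ker (homothety M a)) (ker (homothety M a \o homothety M a)).
Definition I_coreduced (M : Mod R) : Prop := forall a : R, a \in I ->
  isomorphic_modules (coker (homothety M a))
    (coker (homothety M a \o homothety M a)).
Definition I_torsion (M : Mod R) : Prop := isomorphic_modules (Gamma I M) M.
Definition I_complete (M : Mod R) : Prop := isomorphic_modules (Lambda I M) M.

Definition in_E (M : Mod R) : Prop := I_complete M /\ I_coreduced M.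
Definition in_D (M : Mod R) : Prop := I_torsion M /\ I_reduced M.

End ModuleClasses.

(* Main.v *)
Require Import Defs.
From HB Require Import structures.
From mathcomp Require Import all_boot all_algebra.
From mathcomp Require Import boolp.

(** Both subcategories consist of the modules [M] with [I M = 0], and on these
    modules torsion and completion change nothing.

    If [M] is reduced, [a ^+ k *: m = 0] with [a] in [I] already forces
    [a *: m = 0].  An element of [Gamma I M] is represented by the image of
    [1] under some [R / I ^ k -> M], which is annihilated by [a ^+ k], hence by
    [a]; so [I] annihilates [Gamma I M] ([Gamma_killed]).  Dually, if [M] is
    coreduced, [a *: m] lies in [a ^+ k *: M] for every [k], so it vanishes in
    every [M / I ^ k M], and [I] annihilates [Lambda I M] ([Lambda_killed]).

    Conversely, suppose that [I M = 0].  Then [f_a] and its square both vanish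
    for [a] in [I], so [M] is reduced and coreduced.  Moreover, the evaluation
    [Gamma_eval : Gamma I M -> M] at [1] is bijective, and so is the retraction
    [Lambda_retract : Lambda I M -> M] given by [Lambda I M -> M / I M = M].
    Being annihilated by [I] is invariant under any isomorphism
    ([iso_killed_by]), and this is all that an abstract isomorphism
    [Gamma I M ~ M] or [Lambda I M ~ M] has to provide; this yields
    [in_D_killed] and [in_E_killed].  Both bijections are natural in [M], so
    their composites identify [Lambda (Gamma M)] and [Gamma (Lambda M)] with
    [M] naturally. *)

Set Implicit Arguments.
Unset Strict Implicit.
Unset Printing Implicit Defensive.

Import GRing.Theory.
Local Open Scope ring_scope.

(** * Modules annihilated by a set of scalars *)

Definition killed_by (R : comPzRingType) (I : {pred R}) (M : lmodType R) : Prop :=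
  forall a m, a \in I -> a *: m = 0 :> M.

Section Killed.
Variables (R : comPzRingType) (I : submodClosed R^o).
Implicit Types (M N : lmodType R) (a b : R).

(** The classes of modules are defined by the bare existence of isomorphisms.
    Annihilation of scalars is the invariant that turns such an existence into
    a statement on elements. *)
Lemma iso_killed_by M N (J : {pred R}) :
  isomorphic_modules M N -> killed_by J M -> killed_by J N.
Proof. by case=> f [g fK gK] kM a n Ja; rewrite -[n]gK -linearZ kM ?raddf0. Qed.

Lemma mem_smul (J : {pred R}) M (N : submodClosed M) a (m : M) :
  a \in J -> m \in N -> a *: m \in smul J N.
Proof.
move=> Ja Nm; rewrite unfold_in; apply/asboolP.
by exists 1%N, (fun=> a), (fun=> m); split=> //; rewrite big_ord1.
Qed.

Lemma smul_ind (J : {pred R}) M (N : submodClosed M) (P : M -> Prop) :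
  P 0 -> (forall u v, P u -> P v -> P (u + v)) ->
  (forall a m, a \in J -> m \in N -> P (a *: m)) ->
  forall m, m \in smul J N -> P m.
Proof.
move=> P0 PD PZ m; rewrite unfold_in => /asboolP[n [a [x [ax ->]]]].
by elim/big_ind: _ => // i _; have [] := ax i; exact: PZ.
Qed.

Lemma mem_ideal_pow k a : a \in I -> a ^+ k \in ideal_pow I k.
Proof. by move=> Ia; elim: k => [//|k IHk]; rewrite exprS; exact: mem_smul. Qed.

Lemma killed_ideal_pow M k : killed_by I M ->
  killed_by (ideal_pow I k.+1) M.
Proof.
move=> kM b m; move: b.
refine (@smul_ind I R^o (ideal_pow I k) (fun b => b *: m = 0) _ _ _)
  => [|u v u0 v0|a b Ia _].
- exact: scale0r.
- by rewrite scalerDl u0 v0 addr0.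
- by rewrite -[a *: b]/(a * b) -scalerA kM.
Qed.

Lemma killed_pow_smul M k (m : M) : killed_by I M ->
  m \in pow_smul I k.+1 M -> m = 0.
Proof.
move=> kM; refine (@smul_ind _ M _ (fun m => m = 0) _ _ _ m)
  => [//|u v -> ->|b x Ib _]; first exact: addr0.
exact: killed_ideal_pow Ib.
Qed.

Lemma killed_homothety_sqr M a : killed_by I M -> a \in I ->
  (homothety M a \o homothety M a : {linear M -> M}) = homothety M a.
Proof. by move=> kM Ia; apply: linear_ext => m; rewrite /= /homothety !kM. Qed.

Lemma killed_reduced M : killed_by I M -> I_reduced I M.
Proof.
by move=> kM a Ia; rewrite killed_homothety_sqr//; exists idfun; exists idfun.
Qed.

Lemma killed_coreduced M : killed_by I M -> I_coreduced I M.
Proof.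
by move=> kM a Ia; rewrite killed_homothety_sqr//; exists idfun; exists idfun.
Qed.

(** * Reduced and coreduced modules, elementwise *)

(** [a] annihilates [Ker f_a], hence also any module isomorphic to it, such as
    [Ker f_a^2]; so [Ker f_a^2] is contained in [Ker f_a]. *)
Lemma reduced_sqr M a (m : M) : I_reduced I M -> a \in I ->
  a *: (a *: m) = 0 -> a *: m = 0.
Proof.
move=> rM Ia a2m0.
have kill1 : killed_by (pred1 a) (ker (homothety M a)).
  move=> _ u /eqP->; apply: val_inj; rewrite [LHS]linearZ.
  by have := valP u; rewrite unfold_in => /eqP.
have kill2 := iso_killed_by (rM a Ia) kill1.
have mK : m \in ker_pred (homothety M a \o homothety M a).
  by rewrite unfold_in; apply/eqP.
have := kill2 a (exist _ m mK) (eqxx a).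
by move=> /(congr1 val); rewrite [val (_ *: _)]linearZ.
Qed.

Lemma reduced_expr M a k (m : M) : I_reduced I M -> a \in I ->
  a ^+ k *: m = 0 -> a *: m = 0.
Proof.
move=> rM Ia; elim: k => [|k IHk].
  by rewrite expr0 scale1r => ->; rewrite scaler0.
case: k IHk => [|k] IHk; first by rewrite expr1.
rewrite !exprS -!scalerA => /(reduced_sqr rM Ia).
by rewrite scalerA -exprS; exact: IHk.
Qed.

(** [a] annihilates [Coker f_a], hence also [Coker f_a^2], which says that
    [a M] is contained in [a^2 M]. *)
Lemma coreduced_sqr M a (m : M) : I_coreduced I M -> a \in I ->
  exists m', a *: m = a *: (a *: m').
Proof.
move=> cM Ia.
have kill1 : killed_by (pred1 a) (coker (homothety M a)).
  move=> _ x /eqP->; have [v ->] := quot_projP x.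
  rewrite -linearZ -(raddf0 (quot_proj _)); apply/quot_proj_eq.
  by rewrite subr0 unfold_in; apply/asboolP; exists v.
have kill2 := iso_killed_by (cM a Ia) kill1.
have := kill2 a (quot_proj _ m) (eqxx a).
rewrite -linearZ -(raddf0 (quot_proj _)) => /quot_proj_eq.
by rewrite subr0 unfold_in => /asboolP.
Qed.

Lemma coreduced_expr M a k (m : M) : I_coreduced I M -> a \in I ->
  exists m', a *: m = a ^+ k.+1 *: m'.
Proof.
move=> cM Ia; elim: k => [|k [m' ->]]; first by exists m; rewrite expr1.
have [m'' e] := coreduced_sqr m' cM Ia; exists m''.
by rewrite exprSr -scalerA e !scalerA -!exprSr.
Qed.

(** * Torsion and completion are annihilated by the ideal *)

Lemma Gamma_killed M : I_reduced I M -> killed_by I (Gamma I M).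
Proof.
move=> rM a x Ia; have [k [g ->]] := dirlimP x.
(* Already the representative [g] is annihilated by [a], at the same stage. *)
rewrite -linearZ; suff -> : a *: g = 0 by exact: raddf0.
apply: linear_ext => y; have [r ->] := quot_projP y.
(* [a ^+ k *: g r] is [g] at the class of [a ^+ k * r], zero in [R / I ^ k]. *)
apply: (reduced_expr (k := k) rM Ia); rewrite -linearZ -linearZ.
rewrite -[RHS](raddf0 (g : {linear _ -> _})); congr (_ _).
rewrite -(raddf0 (quot_proj _)); apply/quot_proj_eq; rewrite subr0.
by rewrite -[_ *: _]/(_ * _) mulrC; exact/(rpredZ r)/mem_ideal_pow.
Qed.

Lemma Lambda_killed M : I_coreduced I M -> killed_by I (Lambda I M).
Proof.
move=> cM a x Ia; apply: invlim_ext => k; rewrite linearZ raddf0 /=.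
have [m ->] := quot_projP (invlim_proj k x).
rewrite -linearZ -(raddf0 (quot_proj _)); apply/quot_proj_eq; rewrite subr0.
have [m' ->] := coreduced_expr k m cM Ia.
apply: mem_smul => //; apply: (ideal_pow_le (leqnSn k)).
exact: mem_ideal_pow.
Qed.

(** * Evaluation of torsion at one *)

Section TorsionEval.
Variable M : lmodType R.

Definition eval_one k (g : hom_module (ring_quot I k) M) : M :=
  (g : {linear _ -> _}) (quot_proj (ideal_pow I k) 1).
Fact eval_one_linear k : linear (@eval_one k).
Proof. by []. Qed.
HB.instance Definition _ k := GRing.isLinear.Build R
  (hom_module (ring_quot I k) M) M _ (@eval_one k) (@eval_one_linear k).

Fact eval_one_trans i j (h : (i <= j)%N) g :
  eval_one (torsion_trans h g) = eval_one g.
Proof. by rewrite /eval_one /= ring_quot_mapE. Qed.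

(** Its image consists of the elements annihilated by a power of [I], so it
    identifies [Gamma I M] with the usual torsion submodule of [M]. *)
Definition Gamma_eval : {linear Gamma I M -> M} :=
  @dirlim_rec R (torsion_system I M) M (fun k => @eval_one k) eval_one_trans.

Lemma Gamma_evalE k (g : hom_module (ring_quot I k) M) :
  Gamma_eval (@dirlim_in _ (torsion_system I M) k g) = eval_one g.
Proof.
exact: (@dirlim_recE R (torsion_system I M) M (fun k => @eval_one k)
  eval_one_trans).
Qed.

Lemma Gamma_eval_inj : injective Gamma_eval.
Proof.
suff ker0 x : Gamma_eval x = 0 -> x = 0 by exact: raddf_inj.
have [k [g ->]] := dirlimP x; rewrite Gamma_evalE /eval_one => g1.
suff -> : g = 0 by exact: raddf0.
apply: linear_ext => y; have [r ->] := quot_projP y.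
have -> : r = r *: (1 : R^o) by rewrite -[RHS]/(r * 1) mulr1.
by rewrite !linearZ /= g1 scaler0.
Qed.

(** When [I M = 0], every [m] is the value at [1] of the map [r |-> r m], which
    factors through [R / I]. *)
Lemma Gamma_eval_bij : killed_by I M -> bijective Gamma_eval.
Proof.
move=> kM; suff surj m : exists x, Gamma_eval x = m.
  have [g gK] := choice surj.
  by exists g => // x; apply: Gamma_eval_inj; rewrite gK.
have act_linear : linear (fun r : R^o => r *: m).
  by move=> a r s; rewrite scalerDl scalerA.
pose act_mixin := GRing.isLinear.Build R R^o M _ _ act_linear.
pose act : {linear R^o -> M} := HB.pack (fun r : R^o => r *: m) act_mixin.
have act0 r : r \in ideal_pow I 1 -> act r = 0.
  exact: killed_ideal_pow.
pose g : hom_module (ring_quot I 1) M := quot_lift act0.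
exists (@dirlim_in _ (torsion_system I M) 1 g).
by rewrite Gamma_evalE /eval_one [LHS](quot_liftE act0) /= scale1r.
Qed.

End TorsionEval.

Lemma Gamma_eval_natural M N (f : {linear M -> N}) x :
  Gamma_eval N (Gamma_map I f x) = f (Gamma_eval M x).
Proof.
by have [k [g ->]] := dirlimP x; rewrite Gamma_mapE !Gamma_evalE.
Qed.

(** * Retraction of the completion of a module annihilated by the ideal *)

Section CompletionRetract.
Variables (M : lmodType R) (kM : killed_by I M).

Fact Lambda_retract_subproof m : m \in pow_smul I 1 M -> idfun m = 0.
Proof. exact: killed_pow_smul. Qed.

(** Stage [1] is the first informative one: [M / I M] is [M] itself, whereas
    [M / I ^ 0 M] is zero. *)
Definition Lambda_retract : {linear Lambda I M -> M} :=
  lin_comp (quot_lift Lambda_retract_subproof)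
    (@invlim_proj R (completion_system I M) 1
       : {linear Lambda I M -> completion_system I M 1%N}).

Lemma Lambda_retractE m x :
  @invlim_proj _ (completion_system I M) 1 x = quot_proj _ m ->
  Lambda_retract x = m.
Proof. by move=> /= ->; exact: quot_liftE. Qed.

(** Since [I ^ k M = 0] for [k > 0], a compatible family is determined by its
    component at stage [1]. *)
Lemma Lambda_proj_retract k x :
  @invlim_proj _ (completion_system I M) k x =
  quot_proj _ (Lambda_retract x).
Proof.
case: k => [|k].
  (* At stage [0] any two elements agree, the difference being [1 *: _]. *)
  have [m ->] := quot_projP (invlim_proj 0 x); apply/quot_proj_eq.
  by rewrite -[_ - _]scale1r; apply: mem_smul.
have [m xm] := quot_projP (invlim_proj k.+1 x).
rewrite xm; congr quot_proj; symmetry; apply: Lambda_retractE.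
by rewrite -(invlim_projP x (ltn0Sn k)) xm completion_transE.
Qed.

Lemma Lambda_retract_bij : bijective Lambda_retract.
Proof.
pose g := @invlim_lift _ (completion_system I M) M
  (fun k => quot_proj (pow_smul I k M)) (@completion_transE _ I M).
exists g => [x|m]; last exact: Lambda_retractE.
by apply: invlim_ext => k; rewrite invlim_liftE (Lambda_proj_retract k x).
Qed.

End CompletionRetract.

Lemma Lambda_retract_natural M N (kM : killed_by I M) (kN : killed_by I N)
    (f : {linear M -> N}) x :
  Lambda_retract kN (Lambda_map I f x) = f (Lambda_retract kM x).
Proof.
apply: Lambda_retractE.
by rewrite Lambda_mapE (Lambda_proj_retract kM 1 x) Lambda_compE.
Qed.

(** * The two subcategories and their equivalence *)

Lemma in_D_killed M : in_D I M <-> killed_by I M.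
Proof.
split=> [[tM rM]|kM]; first exact: iso_killed_by tM (Gamma_killed rM).
by split; [exists (Gamma_eval M); exact: Gamma_eval_bij|exact: killed_reduced].
Qed.

Lemma in_E_killed M : in_E I M <-> killed_by I M.
Proof.
split=> [[tM cM]|kM]; first exact: iso_killed_by tM (Lambda_killed cM).
split; last exact: killed_coreduced.
by exists (Lambda_retract kM); exact: Lambda_retract_bij.
Qed.

End Killed.

Lemma linear_inverse (R : pzRingType) (U V : lmodType R) (f : {linear U -> V}) :
  bijective f -> exists g : {linear V -> U}, cancel f g /\ cancel g f.
Proof.
case=> g fK gK; have lg : linear g by exact: can2_linear fK gK.
pose G := GRing.isLinear.Build R V U _ g lg.
pose g' : {linear V -> U} := HB.pack g G.
by exists g'.
Qed.

Lemma bij_is_iso (R : pzRingType) (P : Mod R -> Prop)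
    (X Y : full_subcategory P) (f : {linear sval X -> sval Y}) :
  bijective f -> @is_iso (full_subcategory P) X Y f.
Proof.
move=> /linear_inverse[g [fK gK]].
by exists g; split; apply: linear_ext.
Qed.

Unset Implicit Arguments.

Theorem theorem1p3 (R : comPzRingType) (I : submodClosed R^o) :
  (forall M : Mod R, I_reduced I M -> in_E I (Gamma_functor I M)) /\
  (forall M : Mod R, I_coreduced I M -> in_D I (Lambda_functor I M)) /\
  (forall M : Mod R, I_reduced I M -> I_coreduced I (Gamma_functor I M)) /\
  (exists (Gamma_DE : forall M : Mod R, in_D I M -> in_E I (Gamma_functor I M))
          (Lambda_ED : forall M : Mod R, in_E I M -> in_D I (Lambda_functor I M)),
      is_equivalence_with_quasi_inverse
        (restrict_functor Gamma_DE) (restrict_functor Lambda_ED)).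
Proof.
have redE (M : Mod R) : I_reduced I M -> in_E I (Gamma_functor I M).
  by move=> rM; apply/in_E_killed; exact: Gamma_killed.
have corD (M : Mod R) : I_coreduced I M -> in_D I (Lambda_functor I M).
  by move=> cM; apply/in_D_killed; exact: Lambda_killed.
split=> //; split=> //; split; first by move=> M /redE[].
have GammaDE (M : Mod R) (h : in_D I M) := redE M h.2.
have LambdaED (M : Mod R) (h : in_E I M) := corD M h.2.
exists GammaDE, LambdaED; split.
- have kG (X : full_subcategory (in_D I)) : killed_by I (Gamma I (sval X)).
    by apply/in_E_killed; apply: GammaDE; exact: svalP.
  exists (fun X => lin_comp (Gamma_eval I (sval X)) (Lambda_retract (kG X))).
  split=> [X|X Y f].
    apply: bij_is_iso; apply: bij_comp; last exact: Lambda_retract_bij.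
    by apply/Gamma_eval_bij/in_D_killed; exact: svalP.
  apply: linear_ext => x.
  have e := Lambda_retract_natural (kG X) (kG Y) (Gamma_map I f) x.
  exact: etrans (congr1 (Gamma_eval I (sval Y)) e) (Gamma_eval_natural f _).
have kE (Y : full_subcategory (in_E I)) : killed_by I (sval Y).
  by apply/in_E_killed; exact: svalP.
exists (fun Y =>
  lin_comp (Lambda_retract (kE Y)) (Gamma_eval I (Lambda I (sval Y)))).
split=> [Y|X Y f].
  apply: bij_is_iso; apply: bij_comp; first exact: Lambda_retract_bij.
  by apply/Gamma_eval_bij/in_D_killed; apply: LambdaED; exact: svalP.
apply: linear_ext => x.
have e := Gamma_eval_natural (Lambda_map I f) x.
exact: etrans (congr1 (Lambda_retract (kE Y)) e)
  (Lambda_retract_natural (kE X) (kE Y) f _).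
Qed.
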